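(* Let $\vec\omega\in\mathbb R^3$ be a constant nonzero vector with $\omega=\|\vec\omega\|$, let $\omega_0>0$ and $\vec r_0,\vec v_0\in\mathbb R^3$. The solution of the problem $$\ddot{\vec r}+2\vec\omega\times\dot{\vec r}+\vec\omega\times(\vec\omega\times\vec r)+\omega_0^2\vec r=\vec 0,\qquad \vec r(0)=\vec r_0,\quad\dot{\vec r}(0)=\vec v_0,$$ is obtained by applying the rotation operator with angular velocity $-\vec\omega$, $$F_{-\omega}(\,\cdot\,)=\frac{\vec\omega\cdot(\,\cdot\,)}{\omega^2}\vec\omega-\frac{\sin(\omega t)}{\omega}\,\vec\omega\times(\,\cdot\,)-\frac{\cos(\omega t)}{\omega^2}\,\vec\omega\times[\vec\omega\times(\,\cdot\,)],$$ to the solution of the nonrotating oscillator $$\ddot{\vec r}+\omega_0^2\vec r=\vec 0,\qquad \vec r(0)=\vec r_0,\quad\dot{\vec r}(0)=\vec v_0+\vec\omega\times\vec r_0 .$$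
   Context: Vectors are in oriented Euclidean three-space; $\times$ is the cross product, $\cdot$ the scalar product, the dot over a symbol denotes $d/dt$. At each time $t$ the operator $F_{-\omega}$ (with that value of $t$) is applied to the value at time $t$ of the vector function. The first problem models the Foucault pendulum. *)

(* Defs.v *)
From HB Require Import structures.
From mathcomp Require Import all_boot all_order all_algebra.
From mathcomp Require Import all_classical all_reals all_analysis.

Set Implicit Arguments.
Unset Strict Implicit.
Unset Printing Implicit Defensive.

Import Order.TTheory GRing.Theory Num.Theory.
Import numFieldNormedType.Exports.

Local Open Scope ring_scope.

Definition dotv (R : realType) (u v : 'rV[R]_3) : R :=
  \sum_i u ord0 i * v ord0 i.

(* The norm `|u| that the library puts on matrices is the sup norm, hence this
   separate Euclidean norm. *)
Definition normv (R : realType) (u : 'rV[R]_3) : R := Num.sqrt (dotv u u).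

(* The indices i + 1 and i + 2 are computed modulo 3 in 'I_3, so that the
   entries are (u1 v2 - u2 v1, u2 v0 - u0 v2, u0 v1 - u1 v0). *)
Definition crossv (R : realType) (u v : 'rV[R]_3) : 'rV[R]_3 :=
  \row_(i < 3) (u ord0 (i + 1) * v ord0 (i + 2)
                - u ord0 (i + 2) * v ord0 (i + 1)).

Definition twice_derivable (R : realType) (r : R -> 'rV[R]_3) : Prop :=
  forall t : R, derivable r t 1 /\ derivable r^`()%classic t 1.

Definition oscillator_solution (R : realType) (omega0 : R)
    (r0 v0 : 'rV[R]_3) (r : R -> 'rV[R]_3) : Prop :=
  [/\ twice_derivable r,
      forall t : R, r^`(2)%classic t + omega0 ^+ 2 *: r t = 0,
      r 0 = r0 & r^`()%classic 0 = v0].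

Definition foucault_solution (R : realType) (w : 'rV[R]_3) (omega0 : R)
    (r0 v0 : 'rV[R]_3) (r : R -> 'rV[R]_3) : Prop :=
  [/\ twice_derivable r,
      forall t : R, r^`(2)%classic t + 2 *: crossv w (r^`()%classic t)
                + crossv w (crossv w (r t)) + omega0 ^+ 2 *: r t = 0,
      r 0 = r0 & r^`()%classic 0 = v0].

(* The operator F_{-omega} at time t: rotation with angular velocity - w. *)
Definition rotation_neg (R : realType) (w : 'rV[R]_3) (t : R)
    (x : 'rV[R]_3) : 'rV[R]_3 :=
  let omega := normv w in
  (dotv w x / omega ^+ 2) *: w
  - (sin (omega * t) / omega) *: crossv w x
  - (cos (omega * t) / omega ^+ 2) *: crossv w (crossv w x).

(* Main.v *)
Require Import Defs.
From HB Require Import structures.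
From mathcomp Require Import all_boot all_order all_algebra.
From mathcomp Require Import all_classical all_reals all_analysis.
From mathcomp Require Import ring.

Set Implicit Arguments.
Unset Strict Implicit.
Unset Printing Implicit Defensive.

Import Order.TTheory GRing.Theory Num.Theory.
Import numFieldNormedType.Exports.

Local Open Scope ring_scope.

(** Write C for the linear map [crossv w], [omega] for [normv w] and F(t) for
    [rotation_neg w t].  Since C^3 = - omega^2 C ([crossv_cube]), F(t) is the
    exponential of - t C: it commutes with C, F(0) is the identity
    ([rotation_neg0]) and the derivative of F r is F (r' - C r)
    ([is_derive_rotation_neg]).  Two applications of this rule give
      (F r)'' + 2 C (F r)' + C^2 (F r) = F (r''),
    so F carries every solution of the oscillator equation to a solution of
    the Foucault equation; at t = 0 the initial velocity becomes r'(0) - C r(0),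
    which turns v0 + C r0 into v0 ([rotation_neg_foucault]).

    Uniqueness is an energy argument ([foucault_unique]).  In the inertial frame
    the velocity of a solution d is p = d' + C d, and the equation says that
    p' + C p = - omega0^2 d.  As C is antisymmetric,
    p.p + omega0^2 d.d is constant; for the difference of two solutions with
    the same initial data it vanishes at 0, hence always.  The oscillator is the
    case w = 0 ([foucault_solution0]), so one argument covers both problems,
    and its solution exists by an explicit formula ([oscillator_exists]). *)

(** * Vector algebra in dimension three *)

Lemma row3P (R : realType) (u v : 'rV[R]_3) :
  u ord0 0 = v ord0 0 -> u ord0 1 = v ord0 1 -> u ord0 2 = v ord0 2 -> u = v.
Proof.
move=> e0 e1 e2; apply/rowP => -[[|[|[|//]]] lt_i3].
- by rewrite (_ : Ordinal lt_i3 = 0) //; apply/val_inj.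
- by rewrite (_ : Ordinal lt_i3 = 1) //; apply/val_inj.
- by rewrite (_ : Ordinal lt_i3 = 2) //; apply/val_inj.
Qed.

Lemma dotvE (R : realType) (u v : 'rV[R]_3) :
  dotv u v = u ord0 0 * v ord0 0 + u ord0 1 * v ord0 1 + u ord0 2 * v ord0 2.
Proof.
rewrite /dotv !big_ord_recl big_ord0 addr0 addrA.
by congr (_ + _ * _ + _ * _); congr (_ _ _); apply/val_inj.
Qed.

Lemma crossv0E (R : realType) (u v : 'rV[R]_3) :
  crossv u v ord0 0 = u ord0 1 * v ord0 2 - u ord0 2 * v ord0 1.
Proof. by rewrite mxE; congr (_ * _ - _ * _); congr (_ _ _); apply/val_inj. Qed.

Lemma crossv1E (R : realType) (u v : 'rV[R]_3) :
  crossv u v ord0 1 = u ord0 2 * v ord0 0 - u ord0 0 * v ord0 2.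
Proof. by rewrite mxE; congr (_ * _ - _ * _); congr (_ _ _); apply/val_inj. Qed.

Lemma crossv2E (R : realType) (u v : 'rV[R]_3) :
  crossv u v ord0 2 = u ord0 0 * v ord0 1 - u ord0 1 * v ord0 0.
Proof. by rewrite mxE; congr (_ * _ - _ * _); congr (_ _ _); apply/val_inj. Qed.

Lemma addvE (R : realType) (u v : 'rV[R]_3) i :
  (u + v) ord0 i = u ord0 i + v ord0 i.
Proof. by rewrite mxE. Qed.

Lemma oppvE (R : realType) (u : 'rV[R]_3) i : (- u) ord0 i = - u ord0 i.
Proof. by rewrite mxE. Qed.

Lemma scalevE (R : realType) a (u : 'rV[R]_3) i :
  (a *: u) ord0 i = a * u ord0 i.
Proof. by rewrite mxE. Qed.

Lemma zerovE (R : realType) i : (0 : 'rV[R]_3) ord0 i = 0.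
Proof. by rewrite mxE. Qed.

(** Together with [row3P], this multirule reduces a vector identity to three
    scalar identities, which [ring] or [field] decides. *)
Definition coordE :=
  (addvE, oppvE, scalevE, zerovE, dotvE, crossv0E, crossv1E, crossv2E).

Lemma crossv_is_linear (R : realType) (w : 'rV[R]_3) : linear (crossv w).
Proof. by move=> a x y; apply: row3P; rewrite !coordE; ring. Qed.

HB.instance Definition _ (R : realType) (w : 'rV[R]_3) :=
  GRing.isLinear.Build R 'rV[R]_3 'rV[R]_3 _ (crossv w) (crossv_is_linear w).

Lemma crossv0l (R : realType) (x : 'rV[R]_3) : crossv 0 x = 0.
Proof. by apply: row3P; rewrite !coordE; ring. Qed.

Lemma dotv_eq0 (R : realType) (u : 'rV[R]_3) : dotv u u = 0 -> u = 0.
Proof.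
rewrite /dotv => /eqP; rewrite psumr_eq0 => [/allP u0|i _]; last first.
  by rewrite -expr2 sqr_ge0.
apply/rowP => i; have /= := u0 i (mem_index_enum i).
by rewrite mulf_eq0 orbb mxE => /eqP.
Qed.

Lemma dotv_ge0 (R : realType) (u : 'rV[R]_3) : 0 <= dotv u u.
Proof. by apply: sumr_ge0 => i _; rewrite -expr2 sqr_ge0. Qed.

Lemma sqr_normv (R : realType) (u : 'rV[R]_3) : normv u ^+ 2 = dotv u u.
Proof. by rewrite sqr_sqrtr// dotv_ge0. Qed.

Lemma normv_neq0 (R : realType) (u : 'rV[R]_3) : u != 0 -> normv u != 0.
Proof.
by apply: contra_neq => u0; apply: dotv_eq0; rewrite -sqr_normv u0 expr0n.
Qed.

(** [crossv w] is annihilated by X (X^2 + omega^2): this makes the sine and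
    cosine terms of the rotation differentiate into each other. *)
Lemma crossv_cube (R : realType) (w x : 'rV[R]_3) :
  crossv w (crossv w (crossv w x)) = - (normv w ^+ 2) *: crossv w x.
Proof. by rewrite sqr_normv; apply: row3P; rewrite !coordE; ring. Qed.

Lemma dotv_crossv (R : realType) (w x : 'rV[R]_3) : dotv w (crossv w x) = 0.
Proof. by rewrite !coordE; ring. Qed.

Lemma crossv_crossv (R : realType) (w x : 'rV[R]_3) :
  crossv w (crossv w x) = dotv w x *: w - normv w ^+ 2 *: x.
Proof. by rewrite sqr_normv; apply: row3P; rewrite !coordE; ring. Qed.

Lemma rotation_neg_is_linear (R : realType) (w : 'rV[R]_3) (t : R) :
  linear (rotation_neg w t).
Proof.
move=> a x y; rewrite /rotation_neg.
by apply: row3P; rewrite !coordE; ring.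
Qed.

HB.instance Definition _ (R : realType) (w : 'rV[R]_3) (t : R) :=
  GRing.isLinear.Build R 'rV[R]_3 'rV[R]_3 _ (rotation_neg w t)
    (rotation_neg_is_linear w t).

(** At time 0 the operator is the decomposition of x along w and orthogonally
    to w, by the double cross product formula. *)
Lemma rotation_neg0 (R : realType) (w x : 'rV[R]_3) :
  w != 0 -> rotation_neg w 0 x = x.
Proof.
move=> /normv_neq0 w0; rewrite /rotation_neg mulr0 sin0 cos0 crossv_crossv.
by apply: row3P; rewrite !coordE; field.
Qed.

Lemma rotation_neg_crossv (R : realType) (w x : 'rV[R]_3) (t : R) :
  rotation_neg w t (crossv w x) = crossv w (rotation_neg w t x).
Proof. by rewrite /rotation_neg; apply: row3P; rewrite !coordE; ring. Qed.

(** * Derivatives of vector functions *)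

(** Derivatives of vector functions are computed coordinate by coordinate, so
    that the product rule for real functions gives those for scaling and for the
    dot product. *)
Lemma is_derive_rowP (R : realType) (f : R -> 'rV[R]_3) (df : 'rV[R]_3)
    (t : R) :
  is_derive t 1 f df <->
  forall i, is_derive t 1 (fun s => f s ord0 i) (df ord0 i).
Proof.
split=> [[fd <-] i|fd].
  split; first by move/derivable_mxP : fd; exact.
  by rewrite derive_mx// mxE.
have dv : derivable f t 1.
  by apply/derivable_mxP => i j; rewrite (ord1 i); case: (fd j).
split=> //; rewrite derive_mx//; apply/rowP => j; rewrite mxE.
by case: (fd j).
Qed.

Lemma is_derive_addv (R : realType) (f g : R -> 'rV[R]_3) df dg (t : R) :
  is_derive t 1 f df -> is_derive t 1 g dg ->
  is_derive t 1 (fun s => f s + g s) (df + dg).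
Proof. exact: is_deriveD. Qed.

Lemma is_derive_subv (R : realType) (f g : R -> 'rV[R]_3) df dg (t : R) :
  is_derive t 1 f df -> is_derive t 1 g dg ->
  is_derive t 1 (fun s => f s - g s) (df - dg).
Proof. exact: is_deriveB. Qed.

Lemma is_derive_scalev (R : realType) (a : R -> R) (f : R -> 'rV[R]_3)
    (da : R) df (t : R) :
  is_derive t 1 a da -> is_derive t 1 f df ->
  is_derive t 1 (fun s => a s *: f s) (da *: f t + a t *: df).
Proof.
move=> ad /is_derive_rowP fd; apply/is_derive_rowP => i.
under eq_fun do rewrite mxE.
have := is_deriveM ad (fd i) => H; apply: is_derive_eq.
by rewrite !mxE /GRing.scale/=; ring.
Qed.

Lemma is_derive_dotv (R : realType) (f g : R -> 'rV[R]_3) df dg (t : R) :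
  is_derive t 1 f df -> is_derive t 1 g dg ->
  is_derive t 1 (fun s => dotv (f s) (g s)) (dotv df (g t) + dotv (f t) dg).
Proof.
move=> /is_derive_rowP fd /is_derive_rowP gd.
under eq_fun do rewrite dotvE.
have H i := is_deriveM (fd i) (gd i).
have H01 := is_deriveD (H 0) (H 1).
have H012 := is_deriveD H01 (H 2).
apply: is_derive_eq.
by rewrite !dotvE /GRing.scale/=; ring.
Qed.

Lemma is_derive_crossv (R : realType) (w : 'rV[R]_3) (f : R -> 'rV[R]_3) df
    (t : R) :
  is_derive t 1 f df -> is_derive t 1 (fun s => crossv w (f s)) (crossv w df).
Proof.
move=> /is_derive_rowP fd; apply/is_derive_rowP => i.
under eq_fun do rewrite mxE.
have H k j : is_derive t 1 (fun s => w ord0 j * f s ord0 k) (w ord0 j * df ord0 k).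
  exact: (is_deriveZ (w ord0 j) (fd k)).
by have := is_deriveB (H (i + 2) (i + 1)) (H (i + 1) (i + 2)); rewrite mxE.
Qed.

Lemma is_derive_mulrl (R : realType) (c t : R) :
  is_derive t 1 (fun s => c * s) c.
Proof.
apply: (is_derive_eq (is_deriveZ c (is_derive_id t 1))).
by rewrite /GRing.scale/= mulr1.
Qed.

Lemma is_derive_sinM (R : realType) (c t : R) :
  is_derive t 1 (fun s => sin (c * s)) (c * cos (c * t)).
Proof.
rewrite mulrC.
exact: (is_derive1_comp (is_derive_sin (c * t)) (is_derive_mulrl c t)).
Qed.

Lemma is_derive_cosM (R : realType) (c t : R) :
  is_derive t 1 (fun s => cos (c * s)) (- (c * sin (c * t))).
Proof.
rewrite mulrC -mulNr.
exact: (is_derive1_comp (is_derive_cos (c * t)) (is_derive_mulrl c t)).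
Qed.

Lemma is_derive_divr (R : realType) (f : R -> R) (df c t : R) :
  is_derive t 1 f df -> is_derive t 1 (fun s => f s / c) (df / c).
Proof.
move=> fd; rewrite (_ : (fun s => f s / c) = fun s => c^-1 * f s).
  by rewrite (mulrC df); exact: (is_deriveZ c^-1 fd).
by apply/funext => s; rewrite mulrC.
Qed.

(** The product rule for F(t) = exp (- t C): F' = - C F = - F C. *)
Lemma is_derive_rotation_neg (R : realType) (w : 'rV[R]_3)
    (f : R -> 'rV[R]_3) df (t : R) : w != 0 ->
  is_derive t 1 f df ->
  is_derive t 1 (fun s => rotation_neg w s (f s))
    (rotation_neg w t (df - crossv w (f t))).
Proof.
move=> /normv_neq0 w0 fd; rewrite linearB/= /rotation_neg/= dotv_crossv.
have cf := is_derive_crossv w fd.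
have ccf := is_derive_crossv w cf.
have ad := is_derive_scalev
  (is_derive_divr (normv w ^+ 2) (is_derive_dotv (is_derive_cst w t 1) fd))
  (is_derive_cst w t 1).
have bd := is_derive_scalev
  (is_derive_divr (normv w) (is_derive_sinM (normv w) t)) cf.
have cd := is_derive_scalev
  (is_derive_divr (normv w ^+ 2) (is_derive_cosM (normv w) t)) ccf.
apply: (is_derive_eq (is_derive_subv (is_derive_subv ad bd) cd)).
rewrite crossv_cube.
(* The identity is now linear in the iterated cross products, which can be
   treated as unrelated vectors. *)
move: (crossv w (crossv w df)) (crossv w (crossv w (f t))) => c d.
move: (crossv w df) (crossv w (f t)) => a b.
by apply: row3P; rewrite !coordE /cst ?zerovE; field.
Qed.

Lemma derivable_is_derive1 (R : realType) (f : R -> 'rV[R]_3) (t : R) :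
  derivable f t 1 -> is_derive t 1 f (f^`()%classic t).
Proof. by move=> fd; rewrite derive1E; exact: derivableP. Qed.

Lemma derive1_funE (R : realType) (f df : R -> 'rV[R]_3) :
  (forall t : R, is_derive t 1 f (df t)) -> f^`()%classic = df.
Proof. by move=> fd; apply/funext => t; rewrite derive1E; case: (fd t). Qed.

(** * Solutions of the two problems *)

Lemma foucault_lhsB (R : realType) (w : 'rV[R]_3) (k : R)
    (x y z x' y' z' : 'rV[R]_3) :
  (z - z') + 2 *: crossv w (y - y') + crossv w (crossv w (x - x'))
    + k *: (x - x') =
  (z + 2 *: crossv w y + crossv w (crossv w x) + k *: x)
  - (z' + 2 *: crossv w y' + crossv w (crossv w x') + k *: x').
Proof.
rewrite !(linearB (crossv w))/=.
by apply: row3P; rewrite !(addvE, oppvE, scalevE); ring.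
Qed.

(** With x, y, z the values of r, r', r'', this is the Foucault equation for the
    derivatives of F r once F has been factored out. *)
Lemma foucault_lhs_rotating (R : realType) (w : 'rV[R]_3) (k : R)
    (x y z : 'rV[R]_3) :
  z - crossv w y - crossv w (y - crossv w x) + 2 *: crossv w (y - crossv w x)
    + crossv w (crossv w x) + k *: x = z + k *: x.
Proof.
rewrite !(linearB (crossv w))/=.
by apply: row3P; rewrite !(addvE, oppvE, scalevE); ring.
Qed.

Lemma foucault_solutionI (R : realType) (w r0 v0 : 'rV[R]_3) (omega0 : R)
    (r dr ddr : R -> 'rV[R]_3) :
  (forall t : R, is_derive t 1 r (dr t)) ->
  (forall t : R, is_derive t 1 dr (ddr t)) ->
  (forall t : R, ddr t + 2 *: crossv w (dr t) + crossv w (crossv w (r t))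
    + omega0 ^+ 2 *: r t = 0) ->
  r 0 = r0 -> dr 0 = v0 -> foucault_solution w omega0 r0 v0 r.
Proof.
move=> rd drd eqr r0E v0E.
have r1 := derive1_funE rd; have r2 := derive1_funE drd.
split=> //.
- by move=> t; rewrite r1; split; [case: (rd t) | case: (drd t)].
- by move=> t; rewrite derive1nS derive1n1 r1 r2.
- by rewrite r1.
Qed.

Lemma foucault_solution_is_derive (R : realType) (w r0 v0 : 'rV[R]_3)
    (omega0 : R) (r : R -> 'rV[R]_3) (t : R) :
  foucault_solution w omega0 r0 v0 r ->
  is_derive t 1 r (r^`()%classic t) /\
  is_derive t 1 r^`()%classic (r^`(2)%classic t).
Proof.
case=> rd _ _ _; have [d1 d2] := rd t.
split; first exact: (derivable_is_derive1 d1).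
exact: (derivable_is_derive1 d2).
Qed.

(** This lets every result on the Foucault equation serve for the oscillator. *)
Lemma foucault_solution0 (R : realType) (r0 v0 : 'rV[R]_3) (omega0 : R)
    (r : R -> 'rV[R]_3) :
  foucault_solution 0 omega0 r0 v0 r <-> oscillator_solution omega0 r0 v0 r.
Proof.
by split=> -[dr eqr r0E v0E]; split=> // t; have := eqr t;
  rewrite !crossv0l scaler0 !addr0.
Qed.

(** For position x and velocity y, twice the energy of a unit mass seen from the
    inertial frame, where the velocity is [y + crossv w x]. *)
Definition foucault_energy (R : realType) (w : 'rV[R]_3) (omega0 : R)
    (x y : 'rV[R]_3) : R :=
  dotv (y + crossv w x) (y + crossv w x) + omega0 ^+ 2 * dotv x x.

Lemma foucault_energy0 (R : realType) (w : 'rV[R]_3) (omega0 : R) :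
  foucault_energy w omega0 0 0 = 0.
Proof. by rewrite /foucault_energy !coordE; ring. Qed.

Lemma foucault_energy_eq0 (R : realType) (w : 'rV[R]_3) (omega0 : R)
    (x y : 'rV[R]_3) :
  0 < omega0 -> foucault_energy w omega0 x y = 0 -> x = 0.
Proof.
move=> omega0_gt0 /eqP; rewrite paddr_eq0 ?dotv_ge0//; last first.
  by rewrite mulr_ge0 ?sqr_ge0 ?dotv_ge0.
rewrite mulf_eq0 expf_eq0/= (gt_eqF omega0_gt0)/=.
by move=> /andP[_ /eqP/dotv_eq0].
Qed.

(** With p = d' + C d, the equation reads p' = - C p - omega0^2 d, so that half
    the derivative of the energy is - p.(C p) - omega0^2 p.d + omega0^2 d.d'.
    The first term and d.(p - d') = d.(C d) vanish because C is antisymmetric. *)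
Lemma foucault_energy_constant (R : realType) (w : 'rV[R]_3) (omega0 : R)
    (d dd ddd : R -> 'rV[R]_3) (s t : R) :
  (forall u : R, is_derive u 1 d (dd u)) ->
  (forall u : R, is_derive u 1 dd (ddd u)) ->
  (forall u : R, ddd u + 2 *: crossv w (dd u) + crossv w (crossv w (d u))
    + omega0 ^+ 2 *: d u = 0) ->
  foucault_energy w omega0 (d s) (dd s) = foucault_energy w omega0 (d t) (dd t).
Proof.
move=> d1 d2 eqd.
apply: (@is_derive_0_is_cst _ (fun u => foucault_energy w omega0 (d u) (dd u))).
move=> {s}{}t.
have pd := is_derive_addv (d2 t) (is_derive_crossv w (d1 t)).
have kd := is_deriveZ (omega0 ^+ 2) (is_derive_dotv (d1 t) (d1 t)).
apply: (is_derive_eq (is_deriveD (is_derive_dotv pd pd) kd)).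
have -> : ddd t = - (2 *: crossv w (dd t) + crossv w (crossv w (d t))
    + omega0 ^+ 2 *: d t).
  by apply/eqP; rewrite -addr_eq0 !addrA; apply/eqP/eqd.
by rewrite /GRing.scale/= !coordE; ring.
Qed.

(** The difference of the solutions has zero energy at time 0, hence at all
    times, and omega0^2 d.d is one of the two nonnegative terms of the energy. *)
Lemma foucault_unique (R : realType) (w r0 v0 : 'rV[R]_3) (omega0 : R)
    (r s : R -> 'rV[R]_3) : 0 < omega0 ->
  foucault_solution w omega0 r0 v0 r -> foucault_solution w omega0 r0 v0 s ->
  r = s.
Proof.
move=> omega0_gt0 solr sols; apply/funext => t.
have d1 u := is_derive_subv (foucault_solution_is_derive u solr).1
  (foucault_solution_is_derive u sols).1.
have d2 u := is_derive_subv (foucault_solution_is_derive u solr).2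
  (foucault_solution_is_derive u sols).2.
have [_ eqr r0E rv0E] := solr; have [_ eqs s0E sv0E] := sols.
have eqd u : (r^`(2)%classic u - s^`(2)%classic u)
    + 2 *: crossv w (r^`()%classic u - s^`()%classic u)
    + crossv w (crossv w (r u - s u)) + omega0 ^+ 2 *: (r u - s u) = 0.
  by rewrite foucault_lhsB eqr eqs subrr.
have := foucault_energy_constant t 0 d1 d2 eqd.
rewrite r0E s0E rv0E sv0E (subrr r0) (subrr v0) foucault_energy0.
by move=> /(foucault_energy_eq0 omega0_gt0)/subr0_eq.
Qed.

Lemma oscillator_exists (R : realType) (r0 v0 : 'rV[R]_3) (omega0 : R) :
  omega0 != 0 -> oscillator_solution omega0 r0 v0
    (fun t => cos (omega0 * t) *: r0 + (sin (omega0 * t) / omega0) *: v0).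
Proof.
move=> w0; apply/foucault_solution0; apply: (foucault_solutionI
  (dr := fun t => - (omega0 * sin (omega0 * t)) *: r0 + cos (omega0 * t) *: v0)
  (ddr := fun t => - (omega0 ^+ 2 * cos (omega0 * t)) *: r0
                   - (omega0 * sin (omega0 * t)) *: v0)).
- move=> t.
  apply: (is_derive_eq (is_derive_addv
    (is_derive_scalev (is_derive_cosM omega0 t) (is_derive_cst r0 t 1))
    (is_derive_scalev (is_derive_divr omega0 (is_derive_sinM omega0 t))
      (is_derive_cst v0 t 1)))).
  by apply: row3P; rewrite /cst !coordE; field.
- move=> t.
  have sd := is_deriveZ (- omega0) (is_derive_sinM omega0 t).
  rewrite (_ : (fun u : R => _) =
      (fun u => (- omega0 * sin (omega0 * u)) *: r0 + cos (omega0 * u) *: v0)).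
    apply: (is_derive_eq (is_derive_addv (is_derive_scalev sd (is_derive_cst r0 t 1))
      (is_derive_scalev (is_derive_cosM omega0 t) (is_derive_cst v0 t 1)))).
    by rewrite /GRing.scale/=; apply: row3P; rewrite /cst !coordE; ring.
  by apply/funext => u; rewrite mulNr.
- move=> t; rewrite !crossv0l.
  by apply: row3P; rewrite !(addvE, oppvE, scalevE, zerovE); field.
- by rewrite mulr0 cos0 sin0 mul0r scale1r scale0r addr0.
- by rewrite mulr0 cos0 sin0 mulr0 oppr0 scale1r scale0r add0r.
Qed.

(** The derivatives of F r are F (r' - C r) and
    F (r'' - C r' - C (r' - C r)).  As F is linear and commutes with C, the left
    side of the Foucault equation is F applied to r'' + omega0^2 r. *)
Lemma rotation_neg_foucault (R : realType) (w r0 v0 : 'rV[R]_3) (omega0 : R)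
    (r : R -> 'rV[R]_3) : w != 0 ->
  oscillator_solution omega0 r0 (v0 + crossv w r0) r ->
  foucault_solution w omega0 r0 v0 (fun t => rotation_neg w t (r t)).
Proof.
move=> w0 /foucault_solution0 solr.
have r1 t := (foucault_solution_is_derive t solr).1.
have r2 t := (foucault_solution_is_derive t solr).2.
move/foucault_solution0 : solr => [_ eqr r0E v0E].
have p1 t := is_derive_subv (r2 t) (is_derive_crossv w (r1 t)).
apply: (foucault_solutionI (fun t => is_derive_rotation_neg w0 (r1 t))
  (fun t => is_derive_rotation_neg w0 (p1 t))).
- move=> t.
  (* Pull the whole left side under [rotation_neg w t]; its argument is zero
     by the oscillator equation. *)
  have scaleF a x : a *: rotation_neg w t x = rotation_neg w t (a *: x).
    by rewrite linearZ.
  rewrite -!rotation_neg_crossv !scaleF -!(linearD (rotation_neg w t))/=.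
  by rewrite foucault_lhs_rotating (eqr t) linear0.
- by rewrite rotation_neg0.
- by rewrite rotation_neg0// r0E v0E addrK.
Qed.

Theorem mainTheorem14 (R : realType) (w : 'rV[R]_3) (omega0 : R)
    (r0 v0 : 'rV[R]_3) (hw : w != 0) (homega0 : 0 < omega0) :
  exists r : R -> 'rV[R]_3,
    unique (oscillator_solution omega0 r0 (v0 + crossv w r0)) r /\
    unique (foucault_solution w omega0 r0 v0)
      (fun t => rotation_neg w t (r t)).
Proof.
have solr := oscillator_exists r0 (v0 + crossv w r0) (lt0r_neq0 homega0).
eexists; split; split; first exact: solr.
- move=> s /foucault_solution0; apply: (foucault_unique homega0).
  exact/foucault_solution0.
- exact: rotation_neg_foucault hw solr.
- by move=> s; apply: (foucault_unique homega0);
  exact: rotation_neg_foucault hw solr.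
Qed.
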